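(* Let $K=\mathbb{F}_q$ be a finite field with $q\neq 2$. Let $G$ be a connected bipartite graph with bipartition $(V_1,V_2)$ and let $X$ be the projective algebraic toric set parameterized by the edges of $G$ (defined in the context). If $|V_2|\leq|V_1|$, then $$(|V_1|-1)(q-2)\leq{\rm reg}\, S/I(X)\leq (|V_1|+|V_2|-2)(q-2).$$ Furthermore, equality on the left occurs if $G$ is a complete bipartite graph, and equality on the right occurs if $G$ is a tree.
   Context: Graphs are finite and simple. Let $G$ have vertex set $\{y_1,\ldots,y_n\}$ and edges $f_1,\ldots,f_s$ ($s\geq 1$), and let $v_i=e_j+e_k\in\{0,1\}^n$ be the characteristic vector of $f_i=\{y_j,y_k\}$. Put $K^*=K\setminus\{0\}$ and, for $x\in (K^* )^n$, $x^{v_i}=x_1^{v_{i1}}\cdots x_n^{v_{in}}$. The projective algebraic toric set parameterized by the edges of $G$ is $X=\{[(x^{v_1},\ldots,x^{v_s})] : x\in (K^* )^n\}\subset\mathbb{P}^{s-1}$, the projective space over $K$. $S=K[t_1,\ldots,t_s]$ is a polynomial ring with the standard grading, and $I(X)$ is the ideal of $S$ generated by the homogeneous polynomials vanishing on $X$. The Hilbert function is $H_X(d)=\dim_K (S/I(X))_d$; it is constant, equal to $|X|$, for $d\gg 0$, and ${\rm reg}\,S/I(X)$ is the least integer $p\geq 0$ such that $H_X(d)=|X|$ for all $d\geq p$ (this equals the Castelnuovo-Mumford regularity). A bipartition $(V_1,V_2)$ of $G$ is a partition of the vertex set into two disjoint subsets such that every edge has one end in each; $G$ is complete bipartite if every vertex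 of $V_1$ is joined to every vertex of $V_2$. *)

(* Defs.v *)
From HB Require Import structures.
From mathcomp Require Import all_boot all_order all_algebra.
From mathcomp Require Export mpoly.

Set Implicit Arguments.
Unset Strict Implicit.
Unset Printing Implicit Defensive.

Import GRing.Theory.
Local Open Scope ring_scope.

Record sgraph (n : nat) := SGraph {
  adj :> rel 'I_n;
  adj_sym : ssrbool.symmetric adj;
  adj_irr : irreflexive adj
}.

Definition edge_set n (G : sgraph n) : {set {set 'I_n}} :=
  [set A : {set 'I_n} | [exists j, exists k, G j k && (A == [set j; k])]].

Definition enumerates_edges n s (G : sgraph n) (f : 'I_s -> {set 'I_n}) : Prop :=
  injective f /\ [set f i | i : 'I_s] = edge_set G.

Definition connected n (G : sgraph n) : Prop :=
  forall x y : 'I_n, connect G x y.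

(* The cycles [:: x] and [:: x; y] of MathComp's [cycle] are not cycles of the
   graph; the genuine ones are the duplicate-free ones with at least three
   vertices. *)
Definition acyclic n (G : sgraph n) : Prop :=
  forall p : seq 'I_n, cycle G p -> uniq p -> (size p <= 2)%N.

Definition is_tree n (G : sgraph n) : Prop := connected G /\ acyclic G.

Definition bipartition n (G : sgraph n) (V1 V2 : {set 'I_n}) : Prop :=
  [/\ V1 :|: V2 = [set: 'I_n], [disjoint V1 & V2] &
      forall x y, G x y ->
        (x \in V1 /\ y \in V2) \/ (x \in V2 /\ y \in V1)].

(* Only used together with [bipartition G V1 V2]. *)
Definition complete_between n (G : sgraph n) (V1 V2 : {set 'I_n}) : Prop :=
  forall x y, x \in V1 -> y \in V2 -> G x y.

Section ToricSet.
Variables (K : finFieldType) (n s : nat).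

(* [v] for v <> 0: the class of v modulo nonzero scalars. *)
Definition proj_class (v : 'rV[K]_s) : {set 'rV[K]_s} :=
  [set a *: v | a : K & a != 0].

(* The projective space P^(s-1) over K. *)
Definition proj_space : {set {set 'rV[K]_s}} :=
  [set proj_class v | v : 'rV[K]_s & v != 0].

Definition char_vec (A : {set 'I_n}) (j : 'I_n) : nat := (j \in A).

Definition monom (x : 'rV[K]_n) (v : 'I_n -> nat) : K :=
  \prod_(j < n) x 0 j ^+ v j.

Definition toric_pt (f : 'I_s -> {set 'I_n}) (x : 'rV[K]_n) : 'rV[K]_s :=
  \row_i monom x (char_vec (f i)).

Definition toric_set (f : 'I_s -> {set 'I_n}) : {set {set 'rV[K]_s}} :=
  [set proj_class (toric_pt f x) | x : 'rV[K]_n & [forall j, x 0 j != 0]].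

Lemma toric_set_sub_proj f : (0 < s)%N -> toric_set f \subset proj_space.
Proof.
move=> s0; apply/subsetP => P /imsetP[x]; rewrite inE => /forallP x0 ->.
apply/imsetP; exists (toric_pt f x) => //; rewrite inE.
apply/eqP => /rowP /(_ (Ordinal s0)); rewrite !mxE => /eqP.
by rewrite prodf_seq_eq0 => /hasP[j _ /=]; rewrite expf_eq0 (negbTE (x0 j)) andbF.
Qed.

Definition vanishes_on (p : {mpoly K[s]}) (Y : {set {set 'rV[K]_s}}) : Prop :=
  forall P, P \in Y -> forall v, v \in P -> p.@[fun i => v 0 i] = 0.

Definition ideal_generated (R : comNzRingType) (H : R -> Prop) (p : R) : Prop :=
  exists (m : nat) (g h : 'I_m -> R),
    (forall i, H (h i)) /\ p = \sum_(i < m) g i * h i.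

Definition vanishing_ideal (Y : {set {set 'rV[K]_s}}) : {mpoly K[s]} -> Prop :=
  ideal_generated
    (fun p : {mpoly K[s]} => (exists d, p \is d.-homog) /\ vanishes_on p Y).

(* The image of the subspace A in the quotient V / I has a basis with N
   elements: A contains b_1, ..., b_N whose classes modulo I are linearly
   independent and span the class of every element of A. *)
Definition quot_dim (F : fieldType) (V : lmodType F) (A I : V -> Prop) (N : nat)
    : Prop :=
  exists b : 'I_N -> V,
    [/\ forall i, A (b i),
        forall c : 'I_N -> F, I (\sum_i c i *: b i) -> forall i, c i = 0 &
        forall p, A p -> exists c : 'I_N -> F, I (p - \sum_i c i *: b i)].

(* H_Y(d) = dim_K (S/I(Y))_d = N; the degree d part of S/I(Y) is the image of
   the degree d part of S. *)
Definition hilbert_fun_eq (Y : {set {set 'rV[K]_s}}) (d N : nat) : Prop :=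
  quot_dim (fun p : {mpoly K[s]} => p \is d.-homog : Prop) (vanishing_ideal Y) N.

Definition is_regularity (Y : {set {set 'rV[K]_s}}) (r : nat) : Prop :=
  (forall d, (r <= d)%N -> hilbert_fun_eq Y d #|Y|) /\
  (forall p, (forall d, (p <= d)%N -> hilbert_fun_eq Y d #|Y|) -> (r <= p)%N).

Lemma is_regularity_uniq Y r r' :
  is_regularity Y r -> is_regularity Y r' -> r = r'.
Proof.
move=> [H L] [H' L']; apply/eqP.
by rewrite eqn_leq (L _ H') (L' _ H).
Qed.

End ToricSet.

(* Main.v *)
(* Write m = q - 1.  On the torus (K^* )^n the monomial t^a of degree d restricts to
   the character with exponent sum_i a_i v_i in (Z/m)^n, and distinct characters
   are linearly independent; hence H_X(d) is the number of degree sequences,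
   reduced mod m, of multigraphs with d edges supported on G.  As G is connected
   and bipartite, |X| = m^(n-2) is the number of w in (Z/m)^n whose sums over V_1
   and over V_2 are both d.  So the regularity is the least r such that for all
   d >= r every such w is a degree sequence mod m.
   - Lower bound: a w equal to m - 1 on V_1 but for one vertex needs
     d >= (|V_1| - 1)(m - 1) edges.
   - Upper bound: along a spanning tree w is a combination of n - 1 edges with
     coefficients in Z/m; residues c_1, ..., c_N with sum d mod m lift to naturals
     with sum d as soon as d >= (N - 1)(m - 1).
   - Complete bipartite: lift the values of w on V_1 and on V_2 instead; two
     sequences with equal sums are the degrees of a bipartite multigraph.
   - Tree: the edge vectors are independent mod m, so the coefficients m - 1 on
     all edges but one force d >= (n - 2)(m - 1). *)
Require Import Defs.
From mathcomp Require Import all_boot all_order all_algebra finfield.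
From mathcomp Require Import zify.

Set Implicit Arguments.
Unset Strict Implicit.
Unset Printing Implicit Defensive.

Import GRing.Theory.

(** * Lifting residues modulo q - 1, with [k] standing for q - 3 *)

Section Residues.
Variable k : nat.
Local Notation Z := 'Z_(k.+2).

Lemma Zp_eq_mod (a b : nat) : (a%:R = b%:R :> Z)%R -> a = b %[mod k.+2].
Proof. by move/(congr1 (@nat_of_ord _)); rewrite !val_Zp_nat. Qed.

(** The representatives in [0, k + 1] have a sum S congruent to [d]. If S exceeded [d], the bound on
    [d] would give 0 < S - d <= k + 1, impossible for a multiple of k + 2. So d - S is a nonnegative
    multiple of k + 2 and can be added to a single representative. *)
Lemma lift_residues (I : finType) (A : {set I}) (c : I -> Z) (d : nat) :
  0 < #|A| -> (#|A| - 1) * k.+1 <= d -> (\sum_(i in A) c i = d%:R)%R ->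
  exists a : I -> nat,
    \sum_(i in A) a i = d /\ forall i, i \in A -> ((a i)%:R = c i)%R.
Proof.
move=> /card_gt0P[i0 i0A] led sumc.
set S := \sum_(i in A) (c i : nat).
have eqS : S = d %[mod k.+2].
  apply: Zp_eq_mod; rewrite -sumc natr_sum.
  by apply: eq_bigr => i _; rewrite natr_Zp.
have leSd : S <= d.
  rewrite leqNgt; apply/negP => ltdS.
  have leS : S <= #|A| * k.+1.
    by rewrite -sum_nat_const; apply: leq_sum => i _; rewrite -ltnS ltn_ord.
  move/eqP: eqS; rewrite eqn_mod_dvd ?(ltnW ltdS)// => /dvdn_leq.
  rewrite subn_gt0 => /(_ ltdS) leSd.
  have cA : 0 < #|A| by apply/card_gt0P; exists i0.
  by move: led leS leSd ltdS; case: #|A| cA => // c' _; lia.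
exists (fun i => c i + (i == i0) * (d - S)); split.
  rewrite big_split /= -/S (bigD1 i0)//= eqxx mul1n big1 ?addn0 ?subnKC//.
  by move=> i /andP[_ /negbTE->].
move=> i _; have /dvdnP[e ->] : k.+2 %| d - S.
  by rewrite -eqn_mod_dvd// eq_sym in eqS *; apply/eqP; rewrite eqS.
rewrite natrD natr_Zp mulnA natrM.
have -> : (k.+2%:R = 0 :> Z)%R by rewrite pchar_Zp.
by rewrite mulr0 addr0.
Qed.

End Residues.

(** * Degree sequences modulo q - 1 of multigraphs supported on the edges *)

Section Combinatorics.
Variables (k n s : nat) (G : sgraph n) (f : 'I_s -> {set 'I_n}).
Hypothesis hf : enumerates_edges G f.
Hypothesis hconn : connected G.
Variables (V1 V2 : {set 'I_n}).
Hypothesis hbip : bipartition G V1 V2.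
Local Notation Z := 'Z_(k.+2).

Definition degv (a : 'I_s -> nat) (j : 'I_n) : nat := \sum_i a i * (j \in f i).

Definition realizable (d : nat) (w : 'I_n -> Z) : Prop :=
  exists a : 'I_s -> nat,
    \sum_i a i = d /\ forall j, ((degv a j)%:R = w j)%R.

Definition full (d : nat) : Prop :=
  forall w : 'I_n -> Z,
    (\sum_(j in V1) w j = d%:R)%R -> (\sum_(j in V2) w j = d%:R)%R ->
    realizable d w.

Lemma edgeP (i : 'I_s) : exists x y, G x y /\ f i = [set x; y].
Proof.
have : f i \in edge_set G by rewrite -hf.2; apply/imsetP; exists i.
by rewrite inE => /existsP[x /existsP[y /andP[xy /eqP e]]]; exists x, y.
Qed.

Lemma adj_edge x y : G x y -> exists i, f i = [set x; y].
Proof.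
move=> xy; have : [set x; y] \in edge_set G.
  by rewrite inE; apply/existsP; exists x; apply/existsP; exists y; rewrite xy eqxx.
by rewrite -hf.2 => /imsetP[i _ ->]; exists i.
Qed.

Lemma bip_edge (i : 'I_s) :
  exists x y, [/\ x \in V1, y \in V2, G x y & f i = [set x; y]].
Proof.
have [x [y [xy fi]]] := edgeP i; have [_ _ /(_ x y xy)] := hbip.
case=> -[xV yV]; [exists x, y | exists y, x; rewrite adj_sym setUC]; split; assumption.
Qed.

Lemma notin_V2 x : x \in V1 -> x \notin V2.
Proof. by have [_ /disjointFr d _] := hbip => /d ->. Qed.

Lemma notin_V1 x : x \in V2 -> x \notin V1.
Proof. by have [_ /disjointFl d _] := hbip => /d ->. Qed.

Lemma in_V12 x : (x \in V2) = (x \notin V1).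
Proof.
apply/idP/idP => [/notin_V1//|]; have [e _ _] := hbip.
by have := in_setT x; rewrite -e inE => /orP[->|].
Qed.

Lemma card_V12 : #|V1| + #|V2| = n.
Proof.
have [e d _] := hbip.
by rewrite -cardsUI e disjoint_setI0// cards0 addn0 cardsT card_ord.
Qed.

Lemma edge_sum1 (i : 'I_s) : \sum_(j in V1) (j \in f i) = 1.
Proof.
have [x [y [xV yV _ ->]]] := bip_edge i.
rewrite (bigD1 x)//= !inE eqxx big1 ?addn0// => j /andP[jV /negbTE jx].
rewrite !inE jx /=; case: eqP => // jy.
by move: (notin_V1 yV); rewrite -jy jV.
Qed.

Lemma edge_sum2 (i : 'I_s) : \sum_(j in V2) (j \in f i) = 1.
Proof.
have [x [y [xV yV _ ->]]] := bip_edge i.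
rewrite (bigD1 y)//= !inE eqxx orbT big1 ?addn0// => j /andP[jV /negbTE jx].
rewrite !inE jx orbF; case: eqP => // jy.
by move: (notin_V2 xV); rewrite -jy jV.
Qed.

Lemma degv_sum1 a : \sum_(j in V1) degv a j = \sum_i a i.
Proof.
rewrite exchange_big /=; apply: eq_bigr => i _.
by rewrite -big_distrr /= edge_sum1 muln1.
Qed.

Lemma degv_sum2 a : \sum_(j in V2) degv a j = \sum_i a i.
Proof.
rewrite exchange_big /=; apply: eq_bigr => i _.
by rewrite -big_distrr /= edge_sum2 muln1.
Qed.

Lemma comb_sum1 (P : pred 'I_s) (c : 'I_s -> Z) :
  (\sum_(j in V1) \sum_(i | P i) c i * (j \in f i)%:R = \sum_(i | P i) c i)%R.
Proof.
rewrite exchange_big /=; apply: eq_bigr => i _.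
by rewrite -mulr_sumr -natr_sum edge_sum1 mulr1.
Qed.

Lemma comb_sum2 (P : pred 'I_s) (c : 'I_s -> Z) :
  (\sum_(j in V2) \sum_(i | P i) c i * (j \in f i)%:R = \sum_(i | P i) c i)%R.
Proof.
rewrite exchange_big /=; apply: eq_bigr => i _.
by rewrite -mulr_sumr -natr_sum edge_sum2 mulr1.
Qed.

Lemma full_ge_V1 d r1 r2 : r1 \in V1 -> r2 \in V2 ->
  full d -> (#|V1| - 1) * k.+1 <= d.
Proof.
move=> r1V r2V fd.
(* The values at [r1] and [r2] only correct the two sums to [d]; every other vertex of [V1] carries
   the residue whose least representative is largest. *)
pose w (j : 'I_n) : Z := (if j \in V1 then
     if j == r1 then d%:R - ((#|V1| - 1) * k.+1)%:R else k.+1%:R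
   else if j == r2 then d%:R else 0)%R.
have cV1 : \sum_(i in V1 | i != r1) 1 = #|V1| - 1.
  rewrite sum1_card (cardD1 r1 V1) r1V add1n subn1 /=.
  by apply: eq_card => j; rewrite !inE andbC.
have w1 : (\sum_(j in V1) w j = d%:R)%R.
  rewrite (bigD1 r1)//= {1}/w r1V eqxx.
  rewrite (eq_bigr (fun=> (1 * k.+1)%:R)%R).
    by rewrite -natr_sum -big_distrl cV1 /= subrK.
  by move=> j /andP[jV /negbTE jr]; rewrite /w jV jr mul1n.
have w2 : (\sum_(j in V2) w j = d%:R)%R.
  rewrite (bigD1 r2)//= {1}/w (negbTE (notin_V1 r2V)) eqxx big1 ?addr0//.
  by move=> j /andP[jV /negbTE jr]; rewrite /w (negbTE (notin_V1 jV)) jr.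
have [a [<- aw]] := fd w w1 w2.
rewrite -degv_sum1 (bigD1 r1)//= -cV1 big_distrl /=.
apply: leq_trans (leq_addl _ _); apply: leq_sum => j /andP[jV /negbTE jr].
rewrite mul1n; apply: leq_trans (leq_mod _ k.+2).
have := aw j; rewrite /w jV jr => /Zp_eq_mod ->.
by rewrite modn_small.
Qed.

(** Induction on [d]: while the sums are positive, each side has a vertex of positive demand,
    completeness joins the two by an edge, and removing that edge lowers both sums by one. *)
Lemma bip_degree_seq d (D : 'I_n -> nat) : complete_between G V1 V2 ->
  \sum_(j in V1) D j = d -> \sum_(j in V2) D j = d ->
  exists a : 'I_s -> nat, \sum_i a i = d /\ degv a =1 D.
Proof.
move=> hc; elim: d D => [|d IH] D D1 D2.
  exists (fun=> 0); split; first by rewrite big1.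
  move=> j; rewrite /degv big1//; apply/esym/eqP.
  case jV : (j \in V1).
    by move/eqP: D1; rewrite sum_nat_eq0 => /forallP/(_ j); rewrite jV.
  by move/eqP: D2; rewrite sum_nat_eq0 => /forallP/(_ j); rewrite in_V12 jV.
have pos (V : {set 'I_n}) : \sum_(j in V) D j = d.+1 -> exists2 x, x \in V & 0 < D x.
  move=> DV; have /existsP[x /andP[xV Dx]] : [exists x, (x \in V) && (0 < D x)].
    apply: contraT; rewrite negb_exists => /forallP h.
    move: DV; rewrite big1// => j jV; apply/eqP.
    by have := h j; rewrite jV -eqn0Ngt.
  by exists x.
have [x xV Dx] := pos _ D1; have [y yV Dy] := pos _ D2.
have [i fi] := adj_edge (hc x y xV yV).
have le1 j : (j \in f i) <= D j.
  by rewrite fi !inE; case: eqP => [->//|_]; case: eqP => [->|].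
have [||a [suma aD]] := IH (fun j => D j - (j \in f i)).
- by rewrite sumnB// D1 edge_sum1 subn1.
- by rewrite sumnB// D2 edge_sum2 subn1.
exists (fun i' => a i' + (i' == i)); split.
  rewrite big_split /= suma (bigD1 i)//= eqxx big1 ?addn1//.
  by move=> i' /negbTE->.
move=> j; rewrite /degv; under eq_bigr do rewrite mulnDl.
rewrite big_split /= -/(degv a j) aD (bigD1 i)//= eqxx mul1n big1 ?addn0 ?subnK//.
by move=> i' /negbTE->.
Qed.

(** Each side is lifted separately; [#|V2| <= #|V1|] makes the bound for [V1] sufficient for [V2] as
    well. *)
Lemma full_complete d : complete_between G V1 V2 -> 0 < #|V1| -> 0 < #|V2| ->
  #|V2| <= #|V1| -> (#|V1| - 1) * k.+1 <= d -> full d.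
Proof.
move=> hc V1_gt0 V2_gt0 hle led w w1 w2.
have [a1 [suma1 ha1]] := lift_residues V1_gt0 led w1.
have led2 : (#|V2| - 1) * k.+1 <= d by apply: leq_trans led; rewrite leq_mul2r leq_sub2r.
have [a2 [suma2 ha2]] := lift_residues V2_gt0 led2 w2.
have [||a [suma aD]] := @bip_degree_seq d (fun j => if j \in V1 then a1 j else a2 j) hc.
- by rewrite -suma1; apply: eq_bigr => j ->.
- by rewrite -suma2; apply: eq_bigr => j jV; rewrite (negbTE (notin_V1 jV)).
exists a; split=> // j; rewrite aD; case: ifP => jV; first exact: ha1.
by rewrite ha2 ?in_V12 ?jV.
Qed.

(** Without such an edge [U] would be closed under adjacency, hence everything by connectedness. It
    supplies the edge by which a partial spanning tree grows. *)
Lemma connected_cut (U : {set 'I_n}) x0 y0 : x0 \in U -> y0 \notin U ->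
  exists x y, [/\ x \in U, y \notin U & G x y].
Proof.
move=> xU yU.
have [/existsP[x /existsP[y /and3P[]]]|] :=
  boolP [exists x, exists y, [&& x \in U, y \notin U & G x y]]; first by exists x, y.
rewrite negb_exists => /forallP noc.
have cl : closed G (mem U).
  apply: intro_closed => [|x y xy]; first exact/sym_connect_sym/adj_sym.
  apply: contraLR => yU'.
  apply/negP => xU'; case/existsP: (noc x); exists y; apply/and3P; split; assumption.
by move: yU; rewrite -(closed_connect cl (hconn x0 y0)) xU.
Qed.

(** Stands in for a spanning tree on [U]: the edge vectors of [E] generate all weights supported on
    [U] with equal sums on both sides. *)
Definition spans (E : {set 'I_s}) (U : {set 'I_n}) : Prop :=
  forall w : 'I_n -> Z, (forall j, j \notin U -> w j = 0%R) ->
    (\sum_(j in V1) w j = \sum_(j in V2) w j)%R ->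
    exists c : 'I_s -> Z, forall j, (w j = \sum_(i in E) c i * (j \in f i)%:R)%R.

Lemma spanning_edges : 0 < n ->
  exists E : {set 'I_s}, #|E|.+1 = n /\ spans E setT.
Proof.
move=> n_gt0.
(* The tree grows one vertex at a time; [f i \subset U] ensures that the edge to a new vertex is not
   yet in [E]. *)
suff H m : m < n -> exists U : {set 'I_n}, exists E : {set 'I_s},
    [/\ #|U| = m.+1, #|E| = m, (forall i, i \in E -> f i \subset U) & spans E U].
  have [|U [E [cU cE _ sE]]] := H n.-1; first by rewrite prednK.
  exists E; split; first by rewrite cE prednK.
  have UT : U = setT by apply/eqP; rewrite eqEcard subsetT cardsT card_ord cU prednK /=.
  by rewrite -UT.
elim: m => [|m IH] mn.
  exists [set Ordinal n_gt0], set0; split; rewrite ?cards1 ?cards0//.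
    by move=> i; rewrite inE.
  set r := Ordinal n_gt0 => w w0 w12; exists (fun=> 0%R) => j; rewrite big_set0.
  have [jr|jr] := eqVneq j r; last by apply: w0; rewrite inE.
  (* A weight supported at [r] alone has sum [w r] on one side and 0 on the other, so equal sums
     force it to vanish. *)
  have sw (V : {set 'I_n}) : r \in V -> (\sum_(j in V) w j = w r)%R.
    move=> rV; rewrite (bigD1 r)//= big1 ?addr0// => i /andP[_ ir].
    by apply: w0; rewrite inE.
  have sw0 (V : {set 'I_n}) : r \notin V -> (\sum_(j in V) w j = 0)%R.
    move=> rV; rewrite big1// => i iV.
    by apply: w0; rewrite inE; apply: contraNneq rV => <-.
  move: w12; rewrite jr; case rV : (r \in V1).
    by rewrite sw// sw0// notin_V2.
  by rewrite sw0 ?rV// sw// in_V12 rV.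
have [U [E [cU cE sub sE]]] := IH (ltnW mn).
have [x0 x0U] : exists x, x \in U by apply/card_gt0P; rewrite cU.
have [y0 y0U] : exists y, y \notin U.
  have /card_gt0P[y] : 0 < #|~: U| by rewrite cardsCs setCK card_ord cU subn_gt0.
  by rewrite inE; exists y.
have [x [y [xU yU xy]]] := connected_cut x0U y0U.
have [i fi] := adj_edge xy.
have iE : i \notin E.
  apply: contra yU => /sub/subsetP; apply; by rewrite fi !inE eqxx orbT.
exists (y |: U), (i |: E); split.
- by rewrite cardsU1 yU cU.
- by rewrite cardsU1 iE cE.
- move=> i'; rewrite !inE => /orP[/eqP->|/sub/subset_trans]; last first.
    by apply; apply: subsetUr.
  by apply/subsetP => z; rewrite fi !inE => /orP[/eqP->|->//]; rewrite xU orbT.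
move=> w w0 w12.
(* Subtracting [w y] times the new edge kills the value at [y] and changes both side sums equally,
   which reduces to [U]. *)
have [||c hc] := sE (fun j => w j - w y * (j \in f i)%:R)%R.
- move=> j jU; have [->|jy] := eqVneq j y.
    by rewrite fi !inE eqxx orbT mulr1 subrr.
  rewrite w0 ?inE ?negb_or ?jy// fi !inE (negbTE jy) orbF.
  by case: eqP => [jx|_]; [rewrite jx xU in jU|rewrite mulr0 subrr].
- by rewrite !sumrB w12 -!mulr_sumr -!natr_sum edge_sum1 edge_sum2.
exists (fun i' => if i' == i then w y else c i') => j.
rewrite big_setU1//= eqxx.
rewrite (eq_bigr (fun i' => c i' * (j \in f i')%:R)%R); last first.
  by move=> i' iE'; case: eqP => // e; rewrite e (negbTE iE) in iE'.
by rewrite -hc addrC subrK.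
Qed.

(** The n - 1 coefficients along a spanning set of edges sum to [d] modulo k + 2, so they lift to
    multiplicities with sum exactly [d]. *)
Lemma full_ge d : 1 < n -> (n - 2) * k.+1 <= d -> full d.
Proof.
move=> n_gt1 led w w1 w2.
have [E [cE sE]] := spanning_edges (ltnW n_gt1).
have [j||c hc] := sE w; [by rewrite inE|by rewrite w1 w2|].
have sumc : (\sum_(i in E) c i = d%:R)%R.
  by rewrite -w1 -comb_sum1; apply: eq_bigr => j _.
have [||a [suma ha]] := lift_residues _ _ sumc; [by lia|by move: led; rewrite -cE; lia|].
exists (fun i => if i \in E then a i else 0); split; first by rewrite -big_mkcond.
move=> j; rewrite hc /degv natr_sum [RHS]big_mkcond /=; apply: eq_bigr => i _.
by case: ifP => [/ha <-|_]; rewrite ?mul0n ?natrM.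
Qed.

(** In a nontrivial relation, the edges with nonzero coefficient form a subgraph [H] without leaves,
    since a single nonzero term at a vertex cannot cancel. Without cycles, paths in [H] could be
    prolonged forever, contradicting finiteness. *)
Lemma acyclic_indep (c : 'I_s -> Z) : acyclic G ->
  (forall j, \sum_i c i * (j \in f i)%:R = 0)%R -> forall i, c i = 0%R.
Proof.
move=> acy hc i0; apply/eqP/negPn/negP => ci0.
pose H x y := G x y && [exists i, (f i == [set x; y]) && (c i != 0%R)].
have Hsym x y : H x y -> H y x by rewrite /H adj_sym setUC.
have HG x y : H x y -> G x y by case/andP.
have next x y : H x y -> exists2 z, z != x & H y z.
  case/andP=> xy /existsP[i /andP[/eqP fi ci]].
  have [i' i'i ci'] : exists2 i', i' != i & (c i' * (y \in f i')%:R != 0)%R.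
    have [/existsP[i' /andP[]]|] :=
      boolP [exists i', (i' != i) && (c i' * (y \in f i')%:R != 0)%R]; first by exists i'.
    rewrite negb_exists => /forallP h.
    have := hc y; rewrite (bigD1 i)//= fi !inE eqxx orbT mulr1 big1 ?addr0.
      by move=> ci0'; rewrite ci0' eqxx in ci.
    by move=> j ji; apply/eqP; have := h j; rewrite ji negbK.
  have yi' : y \in f i' by apply: contraNT ci' => /negbTE ->; rewrite mulr0.
  have ci'0 : c i' != 0%R by apply: contraNneq ci' => ->; rewrite mul0r.
  have [z [yz fi']] : exists z, G y z /\ f i' = [set y; z].
    have [a [b [ab fi']]] := edgeP i'.
    move: yi'; rewrite fi' !inE => /orP[]/eqP->; first by exists b.
    by exists a; rewrite adj_sym setUC.
  exists z; last by rewrite /H yz; apply/existsP; exists i'; rewrite fi' eqxx.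
  by apply: contraNneq i'i => zx; apply/eqP/hf.1; rewrite fi fi' zx setUC.
have long m : exists x y p, [/\ uniq [:: x, y & p], path H x (y :: p) & size p = m].
  elim: m => [|m [x [y [p [u pth <-]]]]].
    have [a [b [ab fi]]] := edgeP i0; exists a, b, [::].
    have Hab : H a b by rewrite /H ab; apply/existsP; exists i0; rewrite fi eqxx.
    split=> //=; last by rewrite Hab.
    by rewrite inE andbT; apply: contraTneq ab => ->; rewrite adj_irr.
  have /andP[Hxy _] := pth.
  have [z zy Hxz] := next _ _ (Hsym _ _ Hxy).
  have zx : z != x by apply: contraTneq (HG _ _ Hxz) => ->; rewrite adj_irr.
  have [zp|zp] := boolP (z \in p); last first.
    exists z, x, (y :: p); split=> //; last by rewrite /= (Hsym _ _ Hxz).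
    by rewrite cons_uniq u andbT !inE !negb_or zx zy zp.
  case/splitPr: zp u pth => p1 p2 u pth.
  (* If the new neighbour [z] of [x] already lies on the path, the segment from [x] to [z] closes up
     to a cycle with at least three vertices. *)
  suff : size [:: x, y & rcons p1 z] <= 2 by rewrite /= size_rcons.
  apply: acy.
    have := sub_path HG pth; rewrite -cat1s -cat_rcons catA cat_path.
    move=> /andP[pG _]; rewrite (cycle_path x) /= last_rcons.
    by move: pG => /= ->; rewrite adj_sym HG.
  by move: u; rewrite -cat_rcons -!cat_cons cat_uniq => /andP[].
have [x [y [p [u _ sp]]]] := long n.
have := max_card (mem [:: x, y & p]); rewrite card_ord (card_uniqP u) /= sp; lia.
Qed.

Lemma full_tree_ge d r1 r2 : r1 \in V1 -> r2 \in V2 ->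
  is_tree G -> full d -> (n - 2) * k.+1 <= d.
Proof.
move=> r1V r2V [_ acy] fd.
have [E [cE _]] := spanning_edges (leq_ltn_trans (leq0n r1) (ltn_ord r1)).
(* The n - 1 spanning edges are among the s edges, so a bound in terms of s suffices. *)
have ns : n - 2 <= s - 1.
  have : #|E| <= s by rewrite -[X in _ <= X](card_ord s) max_card.
  by lia.
apply: leq_trans (leq_mul ns (leqnn _)) _.
(* For s = 0 truncated subtraction makes the bound zero. *)
case s_gt0 : (0 < s); last by move: s_gt0; case: (s).
pose i0 := Ordinal s_gt0.
pose c (i : 'I_s) : Z := (if i == i0 then d%:R - ((s - 1) * k.+1)%:R else k.+1%:R)%R.
have cs : \sum_(i < s | i != i0) 1 = s - 1.
  by rewrite sum1_card cardC1 card_ord subn1.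
have sumc : (\sum_i c i = d%:R)%R.
  rewrite (bigD1 i0)//= {1}/c eqxx.
  rewrite (eq_bigr (fun=> (1 * k.+1)%:R)%R).
    by rewrite -natr_sum -big_distrl cs /= subrK.
  by move=> i /negbTE ii; rewrite /c ii mul1n.
have [||a [<- aw]] := fd (fun j => \sum_i c i * (j \in f i)%:R)%R.
- by rewrite comb_sum1.
- by rewrite comb_sum2.
(* [a] and [c] give the same weights, so independence identifies them modulo k + 2. *)
have ac : forall i, ((a i)%:R - c i = 0)%R.
  apply: acyclic_indep => // j.
  under eq_bigr do rewrite mulrBl.
  rewrite sumrB -aw natr_sum; apply/eqP; rewrite subr_eq0; apply/eqP.
  by apply: eq_bigr => i _; rewrite natrM.
rewrite (bigD1 i0)//= -cs big_distrl /=.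
apply: leq_trans (leq_addl _ _); apply: leq_sum => i /negbTE ii.
rewrite mul1n; apply: leq_trans (leq_mod _ k.+2).
have /eqP := ac i; rewrite subr_eq0 /c ii => /eqP /Zp_eq_mod ->.
by rewrite modn_small.
Qed.

End Combinatorics.

(** * Uniqueness of the dimension of a quotient *)

Section QuotientDimension.
Local Open Scope ring_scope.

(** Expressing each family through the other gives matrices [PM] and [QM]; independence of [b]
    modulo [I] forces their product to be the identity of size [M], so [M <= N]. *)
Lemma quot_dim_le (F : fieldType) (V : lmodType F) (A I : V -> Prop) (M N : nat) :
  I 0 -> (forall u v, I u -> I v -> I (u + v)) -> (forall a u, I u -> I (a *: u)) ->
  quot_dim A I M -> quot_dim A I N -> (M <= N)%N.
Proof.
move=> I0 ID IZ [b [bA bI bS]] [b' [b'A b'I b'S]].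
have Isum (J : finType) (u : J -> V) : (forall j, I (u j)) -> I (\sum_j u j).
  by move=> Iu; apply: (big_ind I).
have [P hP] := fin_all_exists (fun i => b'S _ (bA i)).
have [Q hQ] := fin_all_exists (fun i => bS _ (b'A i)).
pose PM := \matrix_(i, j) P i j; pose QM := \matrix_(i, j) Q i j.
apply: (@mulmx1_min F _ _ PM QM); apply/matrixP => i l.
rewrite !mxE; under eq_bigr do rewrite !mxE.
apply/eqP; rewrite eq_sym -subr_eq0; apply/eqP; move: l.
apply: (bI (fun l => (i == l)%:R - \sum_j P i j * Q j l)).
have -> : \sum_l ((i == l)%:R - \sum_j P i j * Q j l) *: b l =
    (b i - \sum_j P i j *: b' j) + \sum_j P i j *: (b' j - \sum_l Q j l *: b l).
  under eq_bigr do rewrite scalerBl; rewrite sumrB.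
  rewrite (bigD1 i)//= eqxx scale1r big1 ?addr0; last first.
    by move=> l /negbTE li; rewrite eq_sym li scale0r.
  rewrite [X in _ = _ + X](eq_bigr _ (fun j _ => scalerBr _ _ _)).
  rewrite [X in _ = _ + X]sumrB addrA subrK; congr (_ - _).
  under eq_bigr do rewrite scaler_suml.
  rewrite exchange_big; apply: eq_bigr => j _; rewrite scaler_sumr.
  by apply: eq_bigr => l _; rewrite scalerA.
by apply: ID => //; apply: Isum => j; apply: IZ.
Qed.

(** All vectors tested for membership in [I] lie in the subspace [A]. This allows the vanishing
    ideal to be replaced by vanishing on the torus. *)
Lemma quot_dim_ext (F : fieldType) (V : lmodType F) (A I J : V -> Prop) (N : nat) :
  A 0 -> (forall u v, A u -> A v -> A (u + v)) -> (forall a u, A u -> A (a *: u)) ->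
  (forall u, A u -> (I u <-> J u)) -> quot_dim A I N -> quot_dim A J N.
Proof.
move=> A0 AD AZ IJ [b [bA bI bS]].
have Ac (c : 'I_N -> F) : A (\sum_i c i *: b i).
  by apply: (big_ind A) => // i _; apply: AZ.
exists b; split=> // [c /(IJ _ (Ac c))|u Au]; first exact: bI.
have [c hc] := bS u Au; exists c; apply/IJ => //.
by rewrite -scaleN1r; apply: AD => //; apply: AZ.
Qed.

End QuotientDimension.

(** * Linear independence of the characters of the torus *)

Section Characters.
Local Open Scope ring_scope.
Variables (K : finFieldType) (k : nat).
Hypothesis hK : #|K| = k.+3.
Local Notation Z := 'Z_(k.+2).

Lemma card_nz : #|[pred y : K | y != 0]| = k.+2.
Proof.
have := cardC1 (0 : K); rewrite hK /= => <-.
by apply: eq_card => y; rewrite !inE.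
Qed.

(** Translation by 1 permutes [K], so adding 1 to every element leaves the total sum unchanged. *)
Lemma natr_card : (k.+3%:R = 0 :> K).
Proof.
have e : \sum_(y : K) y = \sum_(y : K) y + k.+3%:R.
  by rewrite {1}(reindex_inj (addIr 1)) big_split /= sumr_const hK.
by apply: (addrI (\sum_(y : K) y)); rewrite addr0 -e.
Qed.

Lemma expf_nz (y : K) : y != 0 -> y ^+ k.+2 = 1.
Proof.
by move=> y0; apply: (mulfI y0); rewrite mulr1 -exprS -hK expf_card.
Qed.

Lemma expf_nz_mod (y : K) a : y != 0 -> y ^+ (a %% k.+2)%N = y ^+ a.
Proof. by move=> /expf_nz/expr_mod. Qed.

(** Some unit [y0] has [y0 ^+ e != 1], as at most e mod (k + 2) units can be roots of unity of that
    order. Multiplication by [y0] permutes the units, so the sum equals [y0 ^+ e] times itself. *)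
Lemma sum_nz_pow e : ~~ (k.+2 %| e)%N -> \sum_(y : K | y != 0) y ^+ e = 0.
Proof.
move=> ndiv.
have [y0 y00 ye] : exists2 y : K, y != 0 & y ^+ e != 1.
  have [/existsP[y /andP[]]|] := boolP [exists y : K, (y != 0) && (y ^+ e != 1)].
    by exists y.
  rewrite negb_exists => /forallP h.
  pose e' := (e %% k.+2)%N.
  have e'0 : (0 < e')%N by rewrite lt0n.
  have au : all e'.-unity_root (enum [pred y : K | y != 0]).
    apply/allP => y; rewrite mem_enum inE => y0; rewrite unity_rootE expf_nz_mod//.
    by have := h y; rewrite y0 negbK.
  have := max_unity_roots e'0 au (enum_uniq _).
  by rewrite -cardE card_nz leqNgt ltn_mod.
set S := \sum_(y | _) _.
have : S = y0 ^+ e * S.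
  rewrite {1}/S (reindex_inj (mulfI y00)) /= mulr_sumr.
  apply: eq_big => y; first by rewrite mulf_eq0 negb_or y00.
  by rewrite exprMn.
move/eqP; rewrite -subr_eq0 -{1}[S]mul1r -mulrBl mulf_eq0 subr_eq0 eq_sym (negbTE ye).
by move/eqP.
Qed.

Variable n : nat.

Definition torus : pred 'rV[K]_n := fun x => [forall j, x 0 j != 0].

Definition chr (w : 'I_n -> Z) (x : 'rV[K]_n) : K := \prod_j x 0 j ^+ (w j : nat).

(** Orthogonality: multiplying the relation by the inverse of the character [w0] and summing over
    the torus leaves [c w0] times (k + 2)^n, where k + 2 = -1 in [K]. *)
Lemma chr_indep (c : {ffun 'I_n -> Z} -> K) :
  (forall x, torus x -> \sum_w c w * chr w x = 0) -> forall w, c w = 0.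
Proof.
move=> h w0.
(* The natural number k + 2 - [w0 j] represents the exponent - [w0 j]. *)
pose G (w : {ffun 'I_n -> Z}) (j : 'I_n) (y : K) : K :=
  y ^+ (w j + (k.+2 - w0 j))%N.
have S0 : \sum_(g in ffun_on (fun y : K => y != 0))
   (\sum_w c w * chr w (\row_j g j)) * \prod_(j : 'I_n) g j ^+ (k.+2 - w0 j)%N = 0.
  apply: big1 => g /ffun_onP gn; rewrite h ?mul0r//.
  by apply/forallP => j; rewrite mxE; apply: gn.
have E w : \sum_(g in ffun_on (fun y : K => y != 0)) \prod_(j : 'I_n) G w j (g j) =
    (w == w0)%:R * (-1) ^+ n.
  rewrite -(bigA_distr_big (fun y : K => y != 0) (G w)).
  have [->|ww] := eqVneq w w0.
    rewrite mul1r -[in RHS](card_ord n) -prodr_const; apply: eq_bigr => j _.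
    rewrite /G subnKC; last by rewrite ltnW// ltn_ord.
    rewrite (eq_bigr (fun=> 1)); last by move=> y /expf_nz.
    rewrite sumr_const card_nz; apply/eqP; rewrite -subr_eq0 opprK.
    by rewrite natr1 natr_card.
  have [j wj] : exists j, w j != w0 j.
    by apply/existsP; rewrite -negb_forall; apply: contra ww => /eqfunP ?; apply/eqP/ffunP.
  rewrite mul0r (bigD1 j)//= /G sum_nz_pow ?mul0r//.
  have ltZ (x : Z) : (x < k.+2)%N := ltn_ord x.
  (* The exponent lies strictly between 0 and 2(k + 2), so if divisible by k + 2 it equals k + 2. *)
  apply: contra wj => /dvdnP[q e]; apply/eqP/val_inj => /=.
  move: (ltZ (w j)) (ltZ (w0 j)) e; case: q => [|[|q]]; rewrite ?mulSn; lia.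
move: S0; under eq_bigr do rewrite mulr_suml.
rewrite exchange_big /=.
under eq_bigr => w _.
  rewrite (eq_bigr (fun g : {ffun 'I_n -> K} => c w * \prod_(j : 'I_n) G w j (g j))).
    rewrite -mulr_sumr E; over.
  move=> g _; rewrite -mulrA -big_split; congr (_ * _); apply: eq_bigr => j _.
  by rewrite /G /= mxE exprD.
rewrite (bigD1 w0)//= eqxx mul1r big1 ?addr0; last first.
  by move=> w /negbTE->; rewrite mul0r mulr0.
by move/eqP; rewrite mulf_eq0 signr_eq0 orbF => /eqP.
Qed.

End Characters.

(** * The Hilbert function as a number of characters *)

Section Hilbert.
Local Open Scope ring_scope.
Variables (K : finFieldType) (k : nat).
Hypothesis hK : #|K| = k.+3.
Variables (n s : nat) (f : 'I_s -> {set 'I_n}).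
Local Notation Z := 'Z_(k.+2).

Implicit Type x : 'rV[K]_n.

Definition ev (x : 'rV[K]_n) (p : {mpoly K[s]}) : K :=
  p.@[fun i => toric_pt f x 0 i].

Definition mdegv (a : 'I_s -> nat) : {ffun 'I_n -> Z} :=
  [ffun j => (degv f a j)%:R].

(** The characters to which monomials of degree [d] restrict; bounded multinomials keep the index
    type finite. *)
Definition degree_chars (d : nat) : {set {ffun 'I_n -> Z}} :=
  [set mdegv m | m : 'X_{1..s < d.+1} & mdeg m == d].

Lemma degree_charsP d (w : {ffun 'I_n -> Z}) :
  reflect (realizable f d w) (w \in degree_chars d).
Proof.
apply: (iffP imsetP) => [[m]|[a [suma aw]]].
  by rewrite inE mdegE => /eqP md ->; exists m; split=> // j; rewrite ffunE.
have da : (mdeg [multinom a i | i < s] < d.+1)%N.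
  by rewrite mdegE -suma ltnS; under eq_bigr do rewrite mnmE.
exists (BMultinom da).
  by rewrite inE /= mdegE -suma; under eq_bigr do rewrite mnmE.
apply/ffunP => j; rewrite ffunE -aw /degv.
by congr (_%:R); apply: eq_bigr => i _; rewrite mnmE.
Qed.

Lemma ev_monom x (m : 'X_{1..s}) : torus x -> ev x 'X_[m] = chr (mdegv m) x.
Proof.
move=> /forallP x0; rewrite /ev mevalX.
under eq_bigr do rewrite mxE -prodrXl.
rewrite exchange_big; apply: eq_bigr => j _ /=.
rewrite ffunE val_Zp_nat// expf_nz_mod// /degv expr_sum.
by apply: eq_bigr => i _; rewrite -exprM mulnC.
Qed.

Lemma ev_sum x p : torus x ->
  ev x p = \sum_(m <- msupp p) p@_m * chr (mdegv m) x.
Proof.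
move=> xT; rewrite {1}[p]mpolyE /ev raddf_sum /=; apply: eq_bigr => m _.
by rewrite mevalZ -/(ev x _) ev_monom.
Qed.

Lemma ev_comb x N (c : 'I_N -> K) (b : 'I_N -> 'X_{1..s}) : torus x ->
  ev x (\sum_i c i *: 'X_[b i]) = \sum_i c i * chr (mdegv (b i)) x.
Proof.
move=> xT; rewrite /ev raddf_sum; apply: eq_bigr => i _.
by rewrite /= mevalZ -/(ev x _) ev_monom.
Qed.

Lemma meval_homog d (p : {mpoly K[s]}) a (v : 'rV[K]_s) : p \is d.-homog ->
  p.@[fun i => (a *: v) 0 i] = a ^+ d * p.@[fun i => v 0 i].
Proof.
move=> /dhomogP hp; rewrite !mevalE mulr_sumr; apply: eq_big_seq => m /hp <-.
rewrite mulrCA; congr (_ * _).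
rewrite /= mdegE expr_sum -big_split; apply: eq_bigr => i _ /=.
by rewrite mxE exprMn.
Qed.

(** A homogeneous [p] that vanishes on the torus is itself a generator, since rescaling a
    representative multiplies its value by a d-th power. *)
Lemma vanishing_evP d p : p \is d.-homog ->
  vanishing_ideal (toric_set K f) p <-> forall x, torus x -> ev x p = 0.
Proof.
move=> hp; split=> [[m [g [h [gh ->]]]] x xT|h].
  rewrite /ev raddf_sum /= big1// => i _; rewrite mevalM.
  have [_ hX] := gh i; rewrite (hX (proj_class (toric_pt f x))) ?mulr0//.
    by apply/imsetP; exists x; rewrite ?inE.
  by apply/imsetP; exists 1; rewrite ?inE ?oner_eq0 ?scale1r.
exists 1%N, (fun=> 1), (fun=> p); rewrite big_ord1 mul1r; split=> // _.
split; first by exists d.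
move=> _ /imsetP[x xT ->] _ /imsetP[a _ ->].
rewrite inE in xT; by rewrite (meval_homog _ _ hp) -/(ev x p) h ?mulr0.
Qed.

Lemma quot_dim_ev d N :
  hilbert_fun_eq (toric_set K f) d N <->
  quot_dim (fun p : {mpoly K[s]} => p \is d.-homog : Prop)
    (fun p => forall x, torus x -> ev x p = 0) N.
Proof.
split; apply: quot_dim_ext => //.
- exact: dhomog0.
- by move=> u v; apply: dhomogD.
- by move=> a u; apply: dhomogZ.
- by move=> u hu; apply: vanishing_evP hu.
- exact: dhomog0.
- by move=> u v; apply: dhomogD.
- by move=> a u; apply: dhomogZ.
- by move=> u hu; split=> /(vanishing_evP hu).
Qed.

(** One monomial per character gives a basis: distinct characters are independent, and monomials
    with the same character agree on the torus. *)
Lemma hilbert_fun_card d : hilbert_fun_eq (toric_set K f) d #|degree_chars d|.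
Proof.
apply/quot_dim_ev.
have /fin_all_exists[b hb] : forall i : 'I_#|degree_chars d|,
    exists m : 'X_{1..s}, mdeg m = d /\ mdegv m = enum_val i.
  by move=> i; have /imsetP[m] := enum_valP i; rewrite inE => /eqP md ->; exists m.
exists (fun i => 'X_[b i]); split.
- by move=> i; rewrite dhomogX; apply/eqP; case: (hb i).
- move=> c hc.
  pose C w := \sum_(i | enum_val i == w) c i.
  have C0 : forall w, C w = 0.
    apply: (chr_indep hK) => x xT; rewrite -[RHS](hc x xT) ev_comb//.
    rewrite (partition_big (fun i => enum_val i) predT)//=.
    apply: eq_bigr => w _; rewrite mulr_suml; apply: eq_bigr => i /eqP <-.
    by rewrite (hb i).2.
  move=> i; rewrite -(C0 (enum_val i)) /C (big_pred1 i)//.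
  by move=> j; rewrite /= (inj_eq enum_val_inj).
move=> p hp.
(* The coefficients of [p] are collected by character. *)
exists (fun i => \sum_(m <- msupp p | mdegv m == enum_val i) p@_m) => x xT.
rewrite /ev mevalB -!/(ev x _) ev_sum// ev_comb//; apply/eqP.
rewrite subr_eq0; apply/eqP.
under [RHS]eq_bigr => i _ do rewrite (hb i).2 mulr_suml big_mkcond.
rewrite exchange_big /=; apply: eq_big_seq => m mp.
have mA : mdegv m \in degree_chars d.
  apply/degree_charsP; exists m; split; last by move=> j; rewrite ffunE.
  by rewrite -mdegE; apply: (dhomog_mf hp).
rewrite -big_mkcond /= (big_pred1 (enum_rank_in mA (mdegv m))).
  by rewrite enum_rankK_in.
move=> i /=; apply/eqP/eqP => [e|->]; first by apply: enum_val_inj; rewrite enum_rankK_in.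
by rewrite enum_rankK_in.
Qed.

Lemma hilbert_funP d N :
  hilbert_fun_eq (toric_set K f) d N <-> N = #|degree_chars d|.
Proof.
split=> [h|->]; last exact: hilbert_fun_card.
have h1 := (quot_dim_ev _ _).1 h; have h2 := (quot_dim_ev _ _).1 (hilbert_fun_card d).
have Q := @quot_dim_le K {mpoly K[s]} (fun p => p \is d.-homog)
   (fun p => forall x, torus x -> ev x p = 0).
apply/eqP; rewrite eqn_leq; apply/andP; split; apply: Q => //;
  by [move=> x _; rewrite /ev meval0
     |move=> u v u0 v0 x xT; rewrite /ev mevalD -/(ev x u) -/(ev x v) u0 ?v0 ?addr0
     |move=> a u u0 x xT; rewrite /ev mevalZ -/(ev x u) u0 ?mulr0].
Qed.

End Hilbert.

(** * The size of the toric set, and fullness as maximality of the Hilbert function *)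

Section Cardinality.
Local Open Scope ring_scope.
Variables (K : finFieldType) (k : nat).
Hypothesis hK : #|K| = k.+3.
Variables (n s : nat) (G : sgraph n) (f : 'I_s -> {set 'I_n}).
Hypothesis hf : enumerates_edges G f.
Hypothesis hconn : connected G.
Variables (V1 V2 : {set 'I_n}).
Hypothesis hbip : bipartition G V1 V2.
Variables r1 r2 : 'I_n.
Hypotheses (r1V : r1 \in V1) (r2V : r2 \in V2).
Local Notation Z := 'Z_(k.+2).

Let r12 : r1 != r2.
Proof. by apply: contraTneq r1V => ->; apply: (notin_V1 hbip). Qed.

Let D : {set 'I_n} := ~: [set r1; r2].

Lemma card_nonroots : #|D| = (n - 2)%N.
Proof. by rewrite cardsCs setCK cards2 r12 card_ord. Qed.

Lemma toric_pt_adj (x : 'rV[K]_n) i u v : G u v -> f i = [set u; v] ->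
  toric_pt f x 0 i = x 0 u * x 0 v.
Proof.
move=> uv fi; have uv' : u != v by apply: contraTneq uv => ->; rewrite adj_irr.
rewrite mxE /monom /char_vec fi (bigD1 u)//= (bigD1 v)/=; last by rewrite eq_sym.
rewrite !inE !eqxx orbT !expr1 big1 ?mulr1// => j /andP[/negbTE ju /negbTE jv].
by rewrite !inE ju jv expr0.
Qed.

Lemma proj_class_scale (a : K) (v : 'rV[K]_s) : a != 0 ->
  proj_class (a *: v) = proj_class v.
Proof.
move=> a0; apply/setP => w; apply/imsetP/imsetP => -[b]; rewrite inE => b0 ->.
  by exists (b * a); rewrite ?inE ?mulf_neq0// scalerA.
by exists (b / a); rewrite ?inE ?mulf_neq0 ?invr_eq0// scalerA divfK.
Qed.

(* Modulo scalars, the coordinates at r1 and r2 can be normalized to 1; this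
   determines the remaining coordinates. *)
Lemma card_toric_set : #|toric_set K f| = (k.+2 ^ (n - 2))%N.
Proof.
pose N := pffun_on 1 (mem D) [pred y : K | y != 0].
pose row (g : {ffun 'I_n -> K}) : 'rV[K]_n := \row_j g j.
have Nnz g : g \in N -> forall j, g j != 0.
  move=> /pffun_onP[gD gR] j; case jD : (j \in D).
    by apply: gR; apply: map_f; rewrite mem_enum.
  have := contraFN (fun h => (subsetP gD) j h) jD.
  by rewrite inE negbK => /eqP->; apply: oner_neq0.
have Nr g r : g \in N -> r \notin D -> g r = 1.
  move=> /pffun_onP[gD _] rD; apply/eqP; apply: contraNT rD => gr.
  by apply: (subsetP gD); rewrite inE.
have r1D : r1 \notin D by rewrite !inE eqxx.
have r2D : r2 \notin D by rewrite !inE eqxx orbT.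
have -> : toric_set K f = [set proj_class (toric_pt f (row g)) | g in N].
  apply/setP => P; apply/imsetP/imsetP => [[x]|[g gN ->]]; last first.
    by exists (row g) => //; rewrite inE; apply/forallP => j; rewrite mxE Nnz.
  rewrite inE => /forallP x0 ->.
  (* Every edge meets both sides, so all edge coordinates are divided by the same scalar
     [x 0 r1 * x 0 r2]. *)
  pose g : {ffun 'I_n -> K} := [ffun j => x 0 j / (if j \in V1 then x 0 r1 else x 0 r2)].
  exists g.
    apply/pffun_onP; split.
      apply/subsetP => j; rewrite inE ffunE; apply: contraR; rewrite !inE negbK.
      case/orP=> /eqP->; first by rewrite r1V divff.
      by rewrite (negbTE (notin_V1 hbip r2V)) divff.
    move=> _ /mapP[j _ ->]; rewrite inE ffunE mulf_neq0// invr_eq0.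
    by case: ifP.
  have -> : toric_pt f x = (x 0 r1 * x 0 r2) *: toric_pt f (row g).
    apply/rowP => i; rewrite [RHS]mxE.
    have [u [v [uV vV uv fi]]] := bip_edge hf hbip i.
    rewrite !(toric_pt_adj _ uv fi) !mxE !ffunE uV (negbTE (notin_V1 hbip vV)).
    by rewrite mulrACA [_ * (x 0 u / _)]mulrC divfK// [_ * (x 0 v / _)]mulrC divfK.
  by apply: proj_class_scale; rewrite mulf_neq0.
rewrite card_in_imset; first by rewrite card_pffun_on card_nonroots (card_nz hK).
move=> g h gN hN e; apply/ffunP.
have : toric_pt f (row g) \in proj_class (toric_pt f (row h)).
  by rewrite -e; apply/imsetP; exists 1; rewrite ?inE ?oner_eq0 ?scale1r.
case/imsetP => a; rewrite inE => a0 gh.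
have ghE u v : G u v -> g u * g v = a * (h u * h v).
  move=> uv; have [i fi] := adj_edge hf uv.
  have := congr1 (fun w : 'rV_s => w 0 i) gh.
  by rewrite /= [RHS]mxE !(toric_pt_adj _ uv fi) !mxE.
(* This relation holds at [r1] and spreads along edges; at [r2] it yields [a = 1]. *)
pose P j := g j == (if j \in V1 then 1 else a) * h j.
have cl : closed G P.
  apply: intro_closed => [|u v uv]; first exact/sym_connect_sym/adj_sym.
  rewrite -!topredE /= /P => /eqP gu; have := ghE u v uv; rewrite gu.
  have hu := Nnz h hN u.
  have [_ _ /(_ u v uv)] := hbip; case=> -[uV vV].
    rewrite uV (negbTE (notin_V1 hbip vV)) mul1r mulrCA.
    by move/(mulfI hu)->.
  rewrite vV (negbTE (notin_V1 hbip uV)) mul1r -!mulrA.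
  by move/(mulfI a0)/(mulfI hu)->.
have Pall j : P j.
  have := closed_connect cl (hconn r1 j); rewrite -!topredE /= => <-.
  by rewrite /P r1V !Nr // mul1r eqxx.
have a1 : a = 1.
  have /eqP := Pall r2; rewrite (negbTE (notin_V1 hbip r2V)) !Nr// mulr1.
  by move=> <-.
by move=> j; have /eqP := Pall j; rewrite a1 if_same mul1r.
Qed.

Definition balanced (d : nat) : {set {ffun 'I_n -> Z}} :=
  [set w : {ffun 'I_n -> Z} |
    (\sum_(j in V1) w j == d%:R) && (\sum_(j in V2) w j == d%:R)].

(** The values off [r1] and [r2] are free, and the two sum conditions then determine those at [r1]
    and [r2]. *)
Lemma card_balanced d : #|balanced d| = (k.+2 ^ (n - 2))%N.
Proof.
pose N := pffun_on (0 : Z) (mem D) predT.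
have Nr (g : {ffun 'I_n -> Z}) r : g \in N -> r \notin D -> g r = 0.
  move=> /pffun_onP[gD _] rD; apply/eqP; apply: contraNT rD => gr.
  by apply: (subsetP gD); rewrite inE.
have r1D : r1 \notin D by rewrite !inE eqxx.
have r2D : r2 \notin D by rewrite !inE eqxx orbT.
pose fill (g : {ffun 'I_n -> Z}) : {ffun 'I_n -> Z} := [ffun j =>
  if j == r1 then d%:R - \sum_(i in V1 | i != r1) g i else
  if j == r2 then d%:R - \sum_(i in V2 | i != r2) g i else g j].
have -> : balanced d = [set fill g | g in N].
  apply/setP => w; apply/idP/imsetP => [|[g gN ->]].
    rewrite inE (bigD1 r1 r1V) (bigD1 r2 r2V) /=.
    rewrite -subr_eq0 -[X in _ && X]subr_eq0 => /andP[/eqP w1 /eqP w2].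
    pose g : {ffun 'I_n -> Z} := [ffun j => if j \in D then w j else 0].
    have gw (V : {set 'I_n}) r r' : r' \notin V -> D = ~: [set r; r'] ->
        \sum_(i in V | i != r) g i = \sum_(i in V | i != r) w i.
      move=> r'V DE; apply: eq_bigr => i /andP[iV ir]; rewrite ffunE DE !inE negb_or ir /=.
      by case: eqP => // ir'; rewrite -ir' iV in r'V.
    exists g.
      apply/pffun_onP; split=> [|//]; apply/subsetP => j; rewrite inE ffunE.
      by case: ifP => //; rewrite eqxx.
    apply/ffunP => j; rewrite ffunE; case: eqP => [->|jr1].
      rewrite (gw V1 r1 r2) ?(notin_V1 hbip)//.
      by apply/eqP; rewrite -subr_eq0 opprB addrA w1.
    case: eqP => [->|jr2].
      rewrite (gw V2 r2 r1) ?(notin_V2 hbip)//; last by rewrite /D setUC.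
      by apply/eqP; rewrite -subr_eq0 opprB addrA w2.
    by rewrite ffunE !inE; do 2 case: eqP => //.
  rewrite inE (bigD1 r1 r1V) (bigD1 r2 r2V) /= !ffunE !eqxx [r2 == r1]eq_sym (negbTE r12).
  apply/andP; split; apply/eqP; apply/(canLR (subrK _)).
    congr (_ - _); apply: eq_bigr => i /andP[iV /negbTE ir]; rewrite ffunE ir.
    by case: eqP iV => // ->; rewrite (negbTE (notin_V1 hbip r2V)).
  congr (_ - _); apply: eq_bigr => i /andP[iV /negbTE ir]; rewrite ffunE ir.
  by case: eqP iV => // ->; rewrite (negbTE (notin_V2 hbip r1V)).
rewrite card_in_imset; first by rewrite card_pffun_on card_nonroots cardT -cardE card_ord.
move=> g h gN hN e; apply/ffunP => j.
case jD : (j \in D); last by rewrite !Nr ?jD.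
have := congr1 (fun w : {ffun 'I_n -> Z} => w j) e; rewrite !ffunE.
by move: jD; rewrite !inE negb_or => /andP[/negbTE-> /negbTE->].
Qed.

(** Degree sequences are balanced and [balanced d] has as many elements as the toric set, so equal
    cardinality means that every balanced weight is realizable. *)
Lemma fullP d : reflect (full k f V1 V2 d) (#|degree_chars k f d| == #|toric_set K f|).
Proof.
rewrite card_toric_set -(card_balanced d).
have sub : degree_chars k f d \subset balanced d.
  apply/subsetP => w /degree_charsP[a [suma aw]]; rewrite inE.
  under eq_bigr do rewrite -aw; under [X in _ && (X == _)]eq_bigr do rewrite -aw.
  by rewrite -!natr_sum (degv_sum1 hf hbip) (degv_sum2 hf hbip) suma eqxx.
have -> : (#|degree_chars k f d| == #|balanced d|) = (balanced d \subset degree_chars k f d).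
  by have := subset_leqif_cards sub => -[_ ->]; rewrite eqEsubset sub.
apply: (iffP subsetP) => [h w w1 w2|h w].
  have /degree_charsP : finfun w \in degree_chars k f d.
    apply: h; rewrite inE; under eq_bigr do rewrite ffunE.
    rewrite w1 eqxx; under eq_bigr do rewrite ffunE.
    by rewrite w2 eqxx.
  by case=> a [suma aw]; exists a; split=> // j; rewrite aw ffunE.
by rewrite inE => /andP[/eqP w1 /eqP w2]; apply/degree_charsP/h.
Qed.

End Cardinality.

(** * The regularity as the least threshold for fullness *)

Theorem theorem2p18 (K : finFieldType) (q : nat) (hq : #|K| = q) (q_neq2 : q <> 2)
    (n s : nat) (s_ge1 : 1 <= s)
    (G : sgraph n) (f : 'I_s -> {set 'I_n}) (hf : enumerates_edges G f)
    (hconn : connected G)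
    (V1 V2 : {set 'I_n}) (hbip : bipartition G V1 V2)
    (hle : #|V2| <= #|V1|) :
  exists r : nat,
    [/\ is_regularity (toric_set K f) r,
        (#|V1| - 1) * (q - 2) <= r <= (#|V1| + #|V2| - 2) * (q - 2),
        complete_between G V1 V2 -> r = (#|V1| - 1) * (q - 2) &
        is_tree G -> r = (#|V1| + #|V2| - 2) * (q - 2)].
Proof.
have [k qE] : exists k, q = k.+3.
  by have := finNzRing_gt1 K; rewrite hq => q_gt1; exists (q - 3); lia.
have hK : #|K| = k.+3 by rewrite hq.
have [r1 [r2 [r1V r2V _ _]]] := bip_edge hf hbip (Ordinal s_ge1).
have V1_gt0 : 0 < #|V1| by apply/card_gt0P; exists r1.
have V2_gt0 : 0 < #|V2| by apply/card_gt0P; exists r2.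
have -> : q - 2 = k.+1 by lia.
rewrite (card_V12 hbip).
have n_gt1 : 1 < n by rewrite -(card_V12 hbip); lia.
have fullE := fullP hK hf hconn hbip r1V r2V.
have hilbE d : hilbert_fun_eq (toric_set K f) d #|toric_set K f| <-> full k f V1 V2 d.
  by rewrite (hilbert_funP hK); split=> [e|/fullE/eqP->//]; apply/fullE; rewrite -e.
set N := (n - 2) * k.+1.
have fullN d : N <= d -> full k f V1 V2 d by apply: (full_ge hf hconn hbip n_gt1).
(* Fullness is automatic from [N] on, so checking [d < N] makes the condition decidable and a least
   [p] available. *)
pose P p := [forall d : 'I_N, (p <= d) ==> (#|degree_chars k f d| == #|toric_set K f|)].
have PP p : reflect (forall d, p <= d -> full k f V1 V2 d) (P p).
  apply: (iffP forallP) => [h d pd|h d]; last by apply/implyP => /h/fullE.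
  have [dN|/fullN//] := ltnP d N.
  by apply/fullE; have := h (Ordinal dN); rewrite pd.
have exP : exists p, P p by exists N; apply/PP.
case: (ex_minnP exP) => r /PP fr rmin; exists r.
have ge_r : (#|V1| - 1) * k.+1 <= r by apply: (full_ge_V1 hf hbip r1V r2V); apply: fr.
have le_r : r <= N by apply: rmin; apply/PP.
split; first split.
- by move=> d rd; apply/hilbE/fr.
- by move=> p hp; apply: rmin; apply/PP => d pd; apply/hilbE/hp.
- by rewrite ge_r le_r.
- move=> hc; apply/eqP; rewrite eqn_leq ge_r andbT; apply: rmin; apply/PP => d.
  exact: (full_complete hf hbip hc).
- move=> ht; apply/eqP; rewrite eqn_leq le_r /=.
  by apply: (full_tree_ge hf hconn hbip r1V r2V ht); apply: fr.
Qed.
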